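(* Let $(H;\langle\cdot,\cdot\rangle)$ be an inner product space over $\mathbb{K}$ ($\mathbb{K}=\mathbb{R}$ or $\mathbb{C}$), and let $x,a\in H$, $r>0$ be such that $$\|x-a\|\le r<\|a\| .$$ Then $$0\le\|x\|+\|a\|-\|x+a\|\le\sqrt2\, r\cdot\sqrt{\frac{\operatorname{Re}\langle x,a\rangle}{\sqrt{\|a\|^2-r^2}\left(\sqrt{\|a\|^2-r^2}+\|a\|\right)}} .$$
   Context: $\|z\|=\sqrt{\langle z,z\rangle}$ is the norm induced by the inner product. *)

(* Defs.v *)
(* The real numbers are an arbitrary realType R, the complex
   numbers are R[i], and inner products are the positive definite Hermitian
   forms {dot H for theta} of sesquilinear.v, linear in the first argument. *)
From mathcomp Require Export all_boot all_order all_algebra.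
From mathcomp Require Export reals.
From mathcomp Require Export complex.

Set Implicit Arguments.
Unset Strict Implicit.
Unset Printing Implicit Defensive.

Import Order.TTheory GRing.Theory Num.Theory.

Local Open Scope ring_scope.
Local Open Scope complex_scope.

Variant scalar_kind := RealScalars | ComplexScalars.

Definition scalar_field (R : realType) (k : scalar_kind) : numFieldType :=
  match k with
  | RealScalars => R
  | ComplexScalars => R[i]
  end.

Definition scalar_conj (R : realType) (k : scalar_kind) :
    scalar_field R k -> scalar_field R k :=
  match k with
  | RealScalars => idfun
  | ComplexScalars => @Num.conj R[i]
  end.
Arguments scalar_conj : clear implicits.

Definition scalar_Re (R : realType) (k : scalar_kind) : scalar_field R k -> R :=
  match k with
  | RealScalars => idfun
  | ComplexScalars => @complex.Re R
  end.

Definition inner_product (R : realType) (k : scalar_kind)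
    (H : lmodType (scalar_field R k)) : Type :=
  {dot H for scalar_conj R k}.

Definition inner (R : realType) (k : scalar_kind) (H : lmodType (scalar_field R k))
    (ip : inner_product H) : H -> H -> scalar_field R k :=
  Dot.sort ip.

(* Hermitian symmetry makes <z, z> real, so scalar_Re only transports it from
   the scalar field to R, where Num.sqrt is available for both kinds. *)
Definition inner_norm (R : realType) (k : scalar_kind)
    (H : lmodType (scalar_field R k)) (ip : inner_product H) (z : H) : R :=
  Num.sqrt (scalar_Re (inner ip z z)).

(* Main.v *)
Require Import Defs.
From mathcomp Require Import lra ring.
Import Order.TTheory GRing.Theory Num.Theory.
Local Open Scope ring_scope.

(** Put p = ||x||, A = ||a||, N = ||x + a||, g = Re <x, a> and
    s = sqrt (A^2 - r^2) > 0.  The real part of the inner product is a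
    symmetric, positive semidefinite, real bilinear form, so
    ||x +- a||^2 = p^2 + A^2 +- 2 g and g <= p A ([re_inner_le_norm]).

    The second fact gives the triangle inequality N <= p + A.  For the upper
    bound on the deficit d = p + A - N, the expansions give
    d (p + A + N) = 2 (p A - g), and 0 <= d <= p + A + N yields
    d^2 <= 2 (p A - g).  It remains to bound p A by a multiple of g: the
    hypothesis ||x - a|| <= r says p^2 + s^2 <= 2 g, whence p s <= g by the
    arithmetic-geometric mean inequality, and then
    p A - g <= g (A - s) / s = r^2 g / (s (s + A)),
    since (A - s) (A + s) = r^2.  Taking square roots concludes. *)

(** * Real parts of scalars *)

Lemma scalar_ReD (R : realType) (k : scalar_kind) (z w : scalar_field R k) :
  scalar_Re (z + w) = scalar_Re z + scalar_Re w.
Proof. by case: k z w => // -[? ?] [? ?]. Qed.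

Lemma scalar_ReN (R : realType) (k : scalar_kind) (z : scalar_field R k) :
  scalar_Re (- z) = - scalar_Re z.
Proof. by case: k z => // -[? ?]. Qed.

Lemma scalar_Re_conj (R : realType) (k : scalar_kind) (z : scalar_field R k) :
  scalar_Re (scalar_conj R k z) = scalar_Re z.
Proof. by case: k z => // -[? ?]. Qed.

Lemma scalar_Re_ge0 (R : realType) (k : scalar_kind) (z : scalar_field R k) :
  0 <= z -> 0 <= scalar_Re z.
Proof. by case: k z => //= z; rewrite lecE => /andP[]. Qed.

(** Embedding the reals turns a module over either scalar field into a real
    one without changing the carrier, so both cases share one argument. *)
Definition scalar_of_real (R : realType) (k : scalar_kind) :
    R -> scalar_field R k :=
  match k with
  | RealScalars => idfun
  | ComplexScalars => @real_complex R
  end.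
Arguments scalar_of_real : clear implicits.

Lemma scalar_ReZ (R : realType) (k : scalar_kind) (t : R)
    (z : scalar_field R k) :
  scalar_Re (scalar_of_real R k t * z) = t * scalar_Re z.
Proof. by case: k z => //= -[u v] /=; rewrite mul0r subr0. Qed.

(** * The real part of an inner product *)

Section RealPartOfInnerProduct.
Variables (R : realType) (k : scalar_kind) (H : lmodType (scalar_field R k)).
Variable ip : inner_product H.

Local Notation re_inner x y := (scalar_Re (inner ip x y)).

Lemma re_innerC x y : re_inner x y = re_inner y x.
Proof.
rewrite /inner (@hermitian_subproof _ _ false (scalar_conj R k) ip x y).
by rewrite expr0 mul1r scalar_Re_conj.
Qed.

Lemma re_innerDl x y z : re_inner (x + y) z = re_inner x z + re_inner y z.
Proof. by rewrite /inner linearDl scalar_ReD. Qed.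

Lemma re_innerNl x z : re_inner (- x) z = - re_inner x z.
Proof. by rewrite /inner linearNl scalar_ReN. Qed.

Lemma re_innerZl t x z :
  re_inner (scalar_of_real R k t *: x) z = t * re_inner x z.
Proof. by rewrite /inner linearZl_LR scalar_ReZ. Qed.

Lemma re_inner_ge0 x : 0 <= re_inner x x.
Proof.
apply: scalar_Re_ge0; have [->|x_neq0] := eqVneq x 0.
  by rewrite /inner linear0l.
by apply: ltW; apply: neq0_dnorm_gt0.
Qed.

Lemma inner_norm_ge0 x : 0 <= inner_norm ip x.
Proof. exact: sqrtr_ge0. Qed.

Lemma sqr_inner_norm x : inner_norm ip x ^+ 2 = re_inner x x.
Proof. by rewrite sqr_sqrtr ?re_inner_ge0. Qed.

Lemma sqr_inner_normD x y :
  inner_norm ip (x + y) ^+ 2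
  = inner_norm ip x ^+ 2 + inner_norm ip y ^+ 2 + 2 * re_inner x y.
Proof.
rewrite !sqr_inner_norm !re_innerDl !(re_innerC _ (x + y)) !re_innerDl.
by rewrite (re_innerC y x); ring.
Qed.

Lemma inner_normN x : inner_norm ip (- x) = inner_norm ip x.
Proof. by rewrite /inner_norm re_innerNl re_innerC re_innerNl opprK. Qed.

Lemma sqr_inner_normB x y :
  inner_norm ip (x - y) ^+ 2
  = inner_norm ip x ^+ 2 + inner_norm ip y ^+ 2 - 2 * re_inner x y.
Proof.
by rewrite sqr_inner_normD inner_normN re_innerC re_innerNl re_innerC mulrN.
Qed.

Lemma sqr_inner_normZ t x :
  inner_norm ip (scalar_of_real R k t *: x) ^+ 2
  = t ^+ 2 * inner_norm ip x ^+ 2.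
Proof.
by rewrite !sqr_inner_norm re_innerZl re_innerC re_innerZl mulrA -expr2.
Qed.

(** Cauchy-Schwarz: with A = ||y|| and g = Re <x, y>, the vector A^2 x - g y
    is A^2 times the component of x orthogonal to y for the real form, and
    its squared norm equals A^2 (A^2 ||x||^2 - g^2). *)
Lemma re_inner_le_norm x y :
  0 < inner_norm ip y -> re_inner x y <= inner_norm ip x * inner_norm ip y.
Proof.
set A := inner_norm ip y => A_gt0; set p := inner_norm ip x.
set g := re_inner x y.
have : 0 <= inner_norm ip (scalar_of_real R k (A ^+ 2) *: x
                           - scalar_of_real R k g *: y) ^+ 2.
  exact: sqr_ge0.
rewrite sqr_inner_normB !sqr_inner_normZ re_innerZl (re_innerC x) re_innerZl.
rewrite (re_innerC y) -/A -/p -/g.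
rewrite (_ : _ - _ = A ^+ 2 * ((p * A) ^+ 2 - g ^+ 2)); last by ring.
rewrite pmulr_rge0 ?exprn_gt0 // subr_ge0 => sqg_le.
apply: le_trans (ler_norm g) _.
rewrite -(@ler_pXn2r _ 2) ?nnegrE ?mulr_ge0 ?inner_norm_ge0 //.
by rewrite real_normK ?num_real.
Qed.

End RealPartOfInnerProduct.

(** * The estimate between real numbers *)

Lemma triangle_deficit_ge0 (R : realDomainType) (p A N g : R) :
  0 <= p -> 0 <= A -> 0 <= N -> g <= p * A ->
  N ^+ 2 = p ^+ 2 + A ^+ 2 + 2 * g -> 0 <= p + A - N.
Proof.
move=> p_ge0 A_ge0 N_ge0 gpA N2; rewrite subr_ge0.
rewrite -(@ler_pXn2r _ 2) ?nnegrE ?addr_ge0 // N2; lra.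
Qed.

(** Here the hypothesis [p ^+ 2 + A ^+ 2 - 2 * g <= r ^+ 2] reads
    p^2 + s^2 <= 2 g, so 2 p s <= 2 g because (p - s)^2 >= 0; the rest is
    (A - s) (A + s) = r^2. *)
Lemma norm_product_defect_le (R : rcfType) (p A g r : R) :
  let s := Num.sqrt (A ^+ 2 - r ^+ 2) in
  0 < r -> r < A -> p ^+ 2 + A ^+ 2 - 2 * g <= r ^+ 2 ->
  p * A - g <= r ^+ 2 * (g / (s * (s + A))).
Proof.
move=> s r_gt0 rA xa_le_r.
have A_gt0 : 0 < A by apply: lt_trans rA.
have sA_gt0 : 0 < A ^+ 2 - r ^+ 2 by nra.
have s_gt0 : 0 < s by rewrite sqrtr_gt0.
have s2 : s ^+ 2 = A ^+ 2 - r ^+ 2 by rewrite sqr_sqrtr ?ltW.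
have psg : p * s <= g by have := sqr_ge0 (p - s); nra.
have pA_le : p * A <= g / s * A.
  by rewrite ler_wpM2r ?(ltW A_gt0) // ler_pdivlMr.
have -> : r ^+ 2 * (g / (s * (s + A))) = g / s * A - g.
  have -> : r ^+ 2 = A ^+ 2 - s ^+ 2 by rewrite s2; ring.
  by field; rewrite !gt_eqF ?addr_gt0.
by rewrite lerD2r.
Qed.

Lemma triangle_deficit_le (R : rcfType) (p A N g r : R) :
  let s := Num.sqrt (A ^+ 2 - r ^+ 2) in
  0 <= p -> 0 <= N -> 0 < r -> r < A -> g <= p * A ->
  N ^+ 2 = p ^+ 2 + A ^+ 2 + 2 * g -> p ^+ 2 + A ^+ 2 - 2 * g <= r ^+ 2 ->
  p + A - N <= Num.sqrt 2 * r * Num.sqrt (g / (s * (s + A))).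
Proof.
move=> s p_ge0 N_ge0 r_gt0 rA gpA N2 xa_le_r.
have A_ge0 : 0 <= A by apply/ltW/(lt_trans r_gt0).
have d_ge0 : 0 <= p + A - N by apply: triangle_deficit_ge0 gpA N2.
have defect := norm_product_defect_le _ _ _ _ _ r_gt0 rA xa_le_r.
have q_ge0 : 0 <= g / (s * (s + A)).
  rewrite divr_ge0 ?mulr_ge0 ?addr_ge0 ?sqrtr_ge0 //; nra.
rewrite -(@ler_pXn2r _ 2) ?nnegrE ?mulr_ge0 ?sqrtr_ge0 ?(ltW r_gt0) //.
rewrite !exprMn !sqr_sqrtr // -mulrA.
(* d = p + A - N satisfies d^2 <= d (p + A + N) = 2 (p A - g), as N >= 0 *)
apply: (@le_trans _ _ (2 * (p * A - g))); last by rewrite ler_wpM2l.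
nra.
Qed.

Theorem proposition1 (R : realType) (k : scalar_kind)
    (H : lmodType (scalar_field R k)) (ip : inner_product H) (x a : H) (r : R)
    (r_gt0 : 0 < r)
    (xa_le_r : inner_norm ip (x - a) <= r)
    (r_lt_a : r < inner_norm ip a) :
  0 <= inner_norm ip x + inner_norm ip a - inner_norm ip (x + a)
    <= Num.sqrt 2 * r *
       Num.sqrt (scalar_Re (inner ip x a) /
                 (Num.sqrt (inner_norm ip a ^+ 2 - r ^+ 2) *
                  (Num.sqrt (inner_norm ip a ^+ 2 - r ^+ 2)
                   + inner_norm ip a))).
Proof.
have a_gt0 : 0 < inner_norm ip a by apply: lt_trans r_lt_a.
have g_le := re_inner_le_norm _ _ _ ip x a a_gt0.
have N2 := sqr_inner_normD _ _ _ ip x a.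
apply/andP; split.
  by apply: triangle_deficit_ge0 g_le N2; rewrite ?inner_norm_ge0.
apply: triangle_deficit_le g_le N2 _; rewrite ?inner_norm_ge0 //.
rewrite -sqr_inner_normB ler_pXn2r ?nnegrE ?inner_norm_ge0 //.
exact: ltW.
Qed.
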